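(* For every graph $G$ of order $n$, $$\operatorname{pd}(G) \leq \left\lfloor n-2\sqrt{n}+1 \right\rfloor .$$ Moreover, this bound is sharp for an infinite family of graphs: there are infinitely many pairwise non-isomorphic graphs $G$ for which, with $n=|V(G)|$, equality $\operatorname{pd}(G) = \lfloor n-2\sqrt{n}+1\rfloor$ holds.
   Context: All graphs are finite, simple and undirected, with nonempty vertex set; the order of $G$ is $n=|V(G)|$. Zero forcing: starting from a set $S\subseteq V(G)$ of blue vertices (all others uncolored), at each iteration every blue vertex that is adjacent to exactly one uncolored vertex colors that neighbor blue (all such forces in one iteration being performed simultaneously). $S$ is a zero forcing set if repeated iterations color all of $V(G)$ blue. A minimum zero forcing set is a zero forcing set of minimum cardinality $Z(G)$. The propagation time of a zero forcing set is the number of iterations needed to color the entire graph (it is $0$ for $S=V(G)$). $\operatorname{pt}(G)$ and $\operatorname{PT}(G)$ are respectively the smallest and the largest propagation time over all minimum zero forcing sets of $G$, and $\operatorname{pd}(G)=\operatorname{PT}(G)-\operatorname{pt}(G)$. *)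

(* Defs.v *)
From mathcomp Require Import all_boot all_order all_algebra.
From mathcomp Require Import boolp reals.

Set Implicit Arguments.
Unset Strict Implicit.
Unset Printing Implicit Defensive.

Import Order.TTheory GRing.Theory Num.Theory.
Local Open Scope ring_scope.

Record sgraph := SGraph {
  vertex :> finType;
  adj : rel vertex;
  adj_sym : symmetric adj;
  adj_irrefl : irreflexive adj;
  vertex_gt0 : (0 < #|vertex|)%N }.

Definition isomorphic (G H : sgraph) : Prop :=
  exists2 f : G -> H, bijective f & forall x y, adj (f x) (f y) = adj x y.

Section ZeroForcing.
Variable G : sgraph.
Implicit Types (B S T : {set G}) (t : nat).

Definition nbhd (u : G) : {set G} := [set v | adj u v].

(* N(u) :\: B == [set v] says that v is the only uncolored neighbor of u. *)
Definition zf_step B : {set G} :=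
  B :|: [set v | [exists u in B, nbhd u :\: B == [set v]]].

Definition colors_by S t : bool := iter t zf_step S == [set: G].

Definition zero_forcing S : bool := `[< exists t, colors_by S t >].

(* The value 0 off zero forcing sets is never used below. *)
Definition prop_time S : nat :=
  if pselect (exists t, colors_by S t) is left colS then ex_minn colS else 0%N.

Definition some_min_zf : {set G} :=
  [arg min_(S < [set: G] | zero_forcing S) #|S|].

Definition zf_number : nat := #|some_min_zf|.

Definition min_zf S : bool := zero_forcing S && (#|S| == zf_number).

Definition pt : nat :=
  prop_time [arg min_(S < some_min_zf | min_zf S) prop_time S].

Definition PT : nat :=
  prop_time [arg max_(S > some_min_zf | min_zf S) prop_time S].

Definition pd : int := PT%:Z - pt%:Z.

(* The defaults used in the extrema above satisfy the constraints, so that the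
   extrema are genuine. *)
Lemma zero_forcingT : zero_forcing [set: G].
Proof. by apply/asboolP; exists 0%N; rewrite /colors_by /= eqxx. Qed.

Lemma some_min_zfP : min_zf some_min_zf.
Proof.
rewrite /min_zf /zf_number eqxx andbT /some_min_zf.
by case: arg_minnP => //; exact: zero_forcingT.
Qed.

Lemma min_zfP S :
  reflect (zero_forcing S /\ forall T, zero_forcing T -> (#|S| <= #|T|)%N)
          (min_zf S).
Proof.
rewrite /min_zf /zf_number /some_min_zf.
case: arg_minnP => [|M zfM minM]; first exact: zero_forcingT.
apply: (iffP andP) => [[zfS /eqP->] | [zfS minS]]; split=> //.
by rewrite eqn_leq minS // minM.
Qed.

Lemma prop_timeP S : zero_forcing S ->
  colors_by S (prop_time S) /\ forall t, colors_by S t -> (prop_time S <= t)%N.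
Proof.
move=> /asboolP zfS; rewrite /prop_time.
by case: pselect => // colS; case: ex_minnP.
Qed.

Lemma ptP : (exists2 S, min_zf S & pt = prop_time S) /\
  forall S, min_zf S -> (pt <= prop_time S)%N.
Proof.
rewrite /pt; case: arg_minnP => [|M zfM minM]; first exact: some_min_zfP.
by split=> //; exists M.
Qed.

Lemma PTP : (exists2 S, min_zf S & PT = prop_time S) /\
  forall S, min_zf S -> (prop_time S <= PT)%N.
Proof.
rewrite /PT; case: arg_maxnP => [|M zfM maxM]; first exact: some_min_zfP.
by split=> //; exists M.
Qed.

End ZeroForcing.

Definition pd_bound (R : realType) (n : nat) : int :=
  Num.floor (n%:R - 2 * Num.sqrt n%:R + 1 : R).

(* Main.v *)
(* Upper bound. Throughout the process at most |S| blue vertices have an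
   uncolored neighbor, so an iteration colors at most |S| vertices; it colors at
   least one. With k = Z(G) this gives PT <= n - k and n <= k (pt + 1), hence
   pd <= n + 1 - (k + pt + 1) <= n + 1 - 2 sqrt n.

   Sharpness. Take l = 2p + 1 rows and l + 1 columns, every column being a path.
   Column 0 consists of hubs, each joined to almost all of its row. The first
   row colors the graph in l - 1 iterations. The hubs together with the start of
   a snake through the columns >= 3 force one vertex per iteration: a vertex
   ahead of the front always has two uncolored neighbors.

   The graph has Z = l + 1. Suppose at most l boundary vertices exist at all
   times. A column that is neither blue nor uncolored contains a boundary vertex,
   so some column is always monochromatic. Following the forces one by one, a
   column other than column 1 becomes blue while some column is still uncolored;
   counting boundary vertices by rows and columns then shows that all other
   columns >= 4 are uncolored, and that no force can ever enter them. *)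
Require Import Defs.
From mathcomp Require Import all_boot all_order all_algebra.
From mathcomp Require Import boolp reals.
From mathcomp Require Import zify lra.

Set Implicit Arguments.
Unset Strict Implicit.
Unset Printing Implicit Defensive.

Import Order.TTheory GRing.Theory Num.Theory.
Local Open Scope ring_scope.

(** * Boundary vertices, and forcing one vertex at a time *)

Section Boundary.
Variable G : sgraph.
Implicit Types (B S : {set G}) (u v : G).

Definition boundary B : {set G} := [set u in B | ~~ (nbhd u \subset B)].

Lemma boundaryP B u :
  reflect (u \in B /\ exists2 v, adj u v & v \notin B) (u \in boundary B).
Proof.
rewrite inE; apply: (iffP andP) => [[uB /subsetPn[v]] | [uB [v uv vB]]].
  by rewrite inE => uv vB; split=> //; exists v.
by split=> //; apply/subsetPn; exists v; rewrite ?inE.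
Qed.

Lemma zf_stepP B v :
  reflect (v \in B \/ exists2 u, u \in B & nbhd u :\: B = [set v])
          (v \in zf_step B).
Proof.
rewrite /zf_step in_setU inE.
apply: (iffP orP) => [[vB | /exists_inP[u uB /eqP Nu]] | [vB | [u uB Nu]]].
- by left.
- by right; exists u.
- by left.
- by right; apply/exists_inP; exists u => //; apply/eqP.
Qed.

Lemma sub_zf_step B : B \subset zf_step B.
Proof. exact: subsetUl. Qed.

Lemma card_zf_step B : (#|zf_step B| <= #|B| + #|boundary B|)%N.
Proof.
(* On a forcing vertex [f] picks the vertex it forces; the default [u] never occurs on the
   boundary. *)
pose f u := odflt u [pick v in nbhd u :\: B].
suff sub : zf_step B \subset B :|: f @: boundary B.
  apply: leq_trans (subset_leq_card sub) _.
  by apply: leq_trans (leq_card_setU _ _) _; rewrite leq_add2l leq_imset_card.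
apply/subsetP => v /zf_stepP[vB | [u uB Nu]]; rewrite inE; first by rewrite vB.
have /setDP[uv vB] : v \in nbhd u :\: B by rewrite Nu set11.
rewrite inE in uv.
apply/orP; right; apply/imsetP; exists u.
  by apply/boundaryP; split=> //; exists v.
rewrite /f; case: pickP => [w | /(_ v)].
  by rewrite Nu inE => /eqP->.
by rewrite Nu set11.
Qed.

(* The forcing vertex leaves the boundary when the forced one may enter it. *)
Lemma card_boundary_force B u v : u \in B -> nbhd u :\: B = [set v] ->
  (#|boundary (v |: B)| <= #|boundary B|)%N.
Proof.
move=> uB Nu.
have /setDP[uv vB] : v \in nbhd u :\: B by rewrite Nu set11.
rewrite inE in uv.
have ubd : u \in boundary B by apply/boundaryP; split=> //; exists v.
suff sub : boundary (v |: B) \subset v |: (boundary B :\ u).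
  apply: leq_trans (subset_leq_card sub) _.
  by rewrite (cardsD1 u (boundary B)) ubd cardsU1; lia.
apply/subsetP => x /boundaryP[]; rewrite !inE => /predU1P[-> | xB] [y xy].
  by rewrite eqxx.
rewrite !inE negb_or => /andP[yv yB]; apply/orP; right.
apply/andP; split.
  apply: contraNneq yv => xu; rewrite -in_set1 -Nu !inE yB -xu; exact: xy.
by rewrite xB; apply/subsetPn; exists y; rewrite ?inE.
Qed.

(* Parallel forces can be performed one at a time. *)
Lemma zf_step_invariant (I : {set G} -> Prop) B :
    (forall (C : {set G}) u v, u \in C -> nbhd u :\: C = [set v] ->
       I C -> I (v |: C)) ->
  I B -> I (zf_step B).
Proof.
move=> stepI IB.
have [k] := ubnP #|zf_step B :\: B|.
suff: forall C : {set G}, B \subset C -> C \subset zf_step B -> I C ->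
    (#|zf_step B :\: C| < k)%N -> I (zf_step B).
  by apply; rewrite // sub_zf_step.
elim: k => // k IHk C BC Cstep IC ltk.
have [/eqP | [v]] := set_0Vmem (zf_step B :\: C).
  by rewrite setD_eq0 => stepC; rewrite (_ : zf_step B = C) //; apply/eqP;
    rewrite eqEsubset stepC.
move=> /setDP[vstep vC].
case/zf_stepP: (vstep) => [vB | [u uB Nu]].
  by rewrite (subsetP BC) in vC.
apply: (IHk (v |: C)).
- exact: subset_trans BC (subsetUr _ _).
- by rewrite subUset sub1set vstep.
- apply: (stepI _ u) => //; first exact: (subsetP BC).
  (* [v] is still the only uncolored neighbor of [u], since [C] contains [B] but not [v]. *)
  apply/setP => w; rewrite !inE.
  have := congr1 (fun A : {set G} => w \in A) Nu; rewrite !inE => <-.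
  have [wC | wC] := boolP (w \in C); last first.
    by rewrite (contra (subsetP BC w) wC).
  apply/esym; apply: contraNF vC.
  move=> Nw; suff -> : v = w by [].
  by apply/esym/set1P; rewrite -Nu !inE.
- rewrite setUC -setDDl; move: ltk; rewrite (cardsD1 v) inE vC vstep /=.
  by rewrite ltnS.
Qed.

Lemma iter_zf_step_invariant (I : {set G} -> Prop) S t :
    (forall (C : {set G}) u v, u \in C -> nbhd u :\: C = [set v] ->
       I C -> I (v |: C)) ->
  I S -> I (iter t (@zf_step G) S).
Proof. by move=> stepI IS; elim: t => //= t; apply: zf_step_invariant. Qed.

Lemma card_boundary_iter S t :
  (#|boundary (iter t (@zf_step G) S)| <= #|S|)%N.
Proof.
apply: (@iter_zf_step_invariant (fun C => #|boundary C| <= #|S|)%N).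
  by move=> C u v uC Nu; apply: leq_trans; apply: card_boundary_force Nu.
by apply/subset_leq_card/subsetP => u /boundaryP[].
Qed.

Lemma zero_forcing_invariant (I : {set G} -> Prop) S :
    (forall (C : {set G}) u v, u \in C -> nbhd u :\: C = [set v] ->
       (#|boundary C| <= #|S|)%N -> (#|boundary (v |: C)| <= #|S|)%N ->
       I C -> I (v |: C)) ->
  zero_forcing S -> I S -> I [set: G].
Proof.
move=> stepI /asboolP[t /eqP <-] IS.
suff [] : I (iter t (@zf_step G) S) /\
    (#|boundary (iter t (@zf_step G) S)| <= #|S|)%N by [].
apply: (@iter_zf_step_invariant
  (fun C => I C /\ (#|boundary C| <= #|S|)%N)) => [C u v uC Nu [IC bC] | ].
  have bvC : (#|boundary (v |: C)| <= #|S|)%N.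
    by apply: leq_trans bC; apply: card_boundary_force Nu.
  by split=> //; apply: (stepI _ u).
by split=> //; apply: (card_boundary_iter S 0).
Qed.

(** * Bounds on propagation times, and the upper bound on [pd] *)

Lemma card_le_prop_time S : zero_forcing S ->
  (#|G| <= #|S| * (prop_time S).+1)%N.
Proof.
move=> zfS; have [/eqP col _] := prop_timeP zfS.
rewrite -cardsT -col; elim: (prop_time S) => [|t IHt] /=; first by lia.
have := card_zf_step (iter t (@zf_step G) S).
have := card_boundary_iter S t.
by nia.
Qed.

Lemma prop_time_le_card S : zero_forcing S ->
  (prop_time S <= #|G| - #|S|)%N.
Proof.
move=> zfS; have [/eqP col minS] := prop_timeP zfS.
suff card_iter t : (t <= prop_time S)%N ->
    (#|S| + t <= #|iter t (@zf_step G) S|)%N.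
  by have := card_iter _ (leqnn _); rewrite col cardsT; lia.
elim: t => [|t IHt] ltt; first by rewrite addn0.
rewrite addnS; apply: leq_ltn_trans (IHt (ltnW ltt)) _.
rewrite iterS; set C := iter _ _ _.
rewrite proper_card // properEneq sub_zf_step andbT.
(* An iteration that colors nothing makes the process stationary, so everything would be blue
   already at time [t], before [prop_time S]. *)
apply/eqP => fixC.
have fix_iter s : iter s (@zf_step G) C = C by elim: s => //= s ->.
have : colors_by S t.
  have := col; rewrite -(subnK (ltnW ltt)) iterD fix_iter /C => colC.
  by rewrite /colors_by colC.
by move/minS; rewrite leqNgt ltt.
Qed.

Lemma pd_le_bound (R : realType) : pd G <= pd_bound R #|G|.
Proof.
have [[S /andP[zfS /eqP cardS] ptE] _] := ptP G.
have [[S' /andP[zfS' /eqP cardS'] PTE] _] := PTP G.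
have := card_le_prop_time zfS; have := prop_time_le_card zfS'.
have := max_card (mem S'); rewrite cardS' cardS -ptE -PTE /pd.
move: (PT G) (pt G) (zf_number G) #|G| => P q z n zn Pn nq.
rewrite /pd_bound floor_ge_int.
(* By AM-GM, 4n <= 4z(q + 1) <= (z + q + 1)^2. *)
have le_sqrt : 2 * Num.sqrt n%:R <= (z + q.+1)%:R :> R.
  rewrite -(@ler_pXn2r _ 2) ?nnegrE ?mulr_ge0 ?sqrtr_ge0 //.
  rewrite exprMn sqr_sqrtr // -natrX -natrM -natrX ler_nat.
  by apply: leq_trans (nat_AGM2 z q.+1); rewrite leq_mul2l.
rewrite intrD mulrNz /= -!pmulrn.
have : (P%:R + z%:R <= n%:R :> R) by rewrite -natrD ler_nat; lia.
by move: le_sqrt; rewrite (natrD _ z) -[q.+1%:R]natr1; lra.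
Qed.

(* [tau] is the time at which a vertex turns blue: [forcer] makes it blue in
   time and [blocker] prevents it from being forced earlier. *)
Section Schedule.
Variable tau : G -> nat.
Hypothesis forcer : forall v, (0 < tau v)%N -> exists2 u, adj u v /\
  (tau u < tau v)%N & forall w, adj u w -> w != v -> (tau w < tau v)%N.
Hypothesis blocker : forall u v, adj u v -> ((tau u).+1 < tau v)%N ->
  exists2 w, adj u w /\ w != v & (tau v <= (tau w).+1)%N.

Let start : {set G} := [set v | tau v == 0%N].

Lemma iter_schedule t :
  iter t (@zf_step G) start = [set v | (tau v <= t)%N].
Proof.
elim: t => [|t IHt]; first by apply/setP => v; rewrite !inE leqn0.
rewrite iterS IHt; apply/setP => v; rewrite [RHS]inE.
apply/zf_stepP/idP => [[|[u]] | ].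
- by rewrite inE; lia.
- rewrite inE => tu Nu.
  have /setDP[] : v \in nbhd u :\: [set w | (tau w <= t)%N] by rewrite Nu set11.
  rewrite !inE => uv tv; rewrite leqNgt; apply/negP => tv'.
  (* Were [v] due after [t.+1], its blocker [w] would be a second uncolored neighbor of [u]. *)
  have [|w [uw wv] tw] := blocker uv; first by lia.
  case/eqP: wv; apply/set1P; rewrite -Nu !inE uw andbT; lia.
- rewrite leq_eqVlt ltnS => /orP[/eqP tv | tv]; last by left; rewrite inE.
  have [|u [uv tu] uP] := @forcer v; first by rewrite tv.
  right; exists u; first by rewrite inE; lia.
  apply/setP => w; rewrite !inE.
  have [->|wv] := eqVneq w v; first by rewrite uv andbT; lia.
  by case: (boolP (adj u w)) => [/uP/(_ wv)|]; rewrite ?andbF // andbT tv; lia.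
Qed.

Lemma schedule_zero_forcing : zero_forcing start.
Proof.
apply/asboolP; exists (\max_v tau v); rewrite /colors_by iter_schedule.
by apply/eqP/setP => v; rewrite !inE leq_bigmax.
Qed.

Lemma schedule_prop_time t : (forall v, tau v <= t)%N ->
  (prop_time start <= t)%N.
Proof.
move=> le_t; have [_] := prop_timeP schedule_zero_forcing; apply.
by rewrite /colors_by iter_schedule; apply/eqP/setP => v; rewrite !inE le_t.
Qed.

Lemma schedule_prop_time_ge v : (tau v <= prop_time start)%N.
Proof.
have [/eqP col _] := prop_timeP schedule_zero_forcing.
have : v \in [set: G] by [].
by rewrite -col iter_schedule inE.
Qed.

End Schedule.

End Boundary.

(* Columns: 0 is the hub column, the columns >= 3 carry a snake that runs from
   (0, T.+1) down to column 3, and columns 1 and 2 are swept last. *)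
Definition row_edge (T i a b : nat) : bool :=
  match a with
  | 0 => (2 < b) || (b == (if odd i then 1 else 2))
  | 1 => (b == 2) && (odd i || (i == 0)) || (b == 3) && odd i
  | 2 => (b == 3) && ~~ odd i
  | _ => (b == a.+1) && (i == if odd a then 0 else T)
  end%N.

Definition grid_edge (T i a j b : nat) : bool :=
  ((a == b) && ((j == i.+1) || (i == j.+1)) ||
  (i == j) && (row_edge T i a b || row_edge T i b a))%N.

Arguments grid_edge : simpl never.

(** * The timetable of the snake *)

Definition column_start (T c : nat) : nat := ((T.+1 - c) * T.+1)%N.

(** The snake enters column [c] at [column_start T c] and spends T + 1 iterations in each column
    beyond 3. In column 3 it needs two per row: in between, the hub of the row colors its neighbor
    in column 1 or 2. Finally the rest of column 2 is colored from row T - 1 to row 1, and the rest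
    of column 1 from row 0 to row T. *)
Definition snake_time (T i c : nat) : nat :=
  match c with
  | 0 => 0
  | 1 => if odd i then column_start T 3 + i.*2.+1
         else column_start T 3 + T.*2.+2 + T./2 + i./2
  | 2 => if odd i then column_start T 3 + T.*2.+1 + (T.+1 - i)./2
         else column_start T 3 + i.*2.+1
  | 3 => column_start T 3 + i.*2
  | _ => column_start T c + if odd c then i else T - i
  end%N.

Lemma column_startS T c : (c <= T)%N ->
  column_start T c = (column_start T c.+1 + T.+1)%N.
Proof. by move=> cT; rewrite /column_start subSS subSn // mulSn addnC. Qed.

Lemma column_start_le T c : (c < T.-2)%N ->
  (column_start T c.+4 + T.+1 <= column_start T 3)%N.
Proof. by rewrite /column_start => cT; nia. Qed.

Lemma grid_edgeP T i a j b : grid_edge T i a j b ->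
  [\/ a = b /\ (j = i.+1 \/ i = j.+1), i = j /\ row_edge T i a b
    | i = j /\ row_edge T i b a].
Proof.
case/orP => [/andP[/eqP-> /orP[] /eqP->] | /andP[/eqP-> /orP[]]];
  by [constructor 1; auto | constructor 2 | constructor 3].
Qed.

Lemma grid_edge_sym T i a j b : grid_edge T i a j b = grid_edge T j b i a.
Proof.
rewrite /grid_edge (eq_sym b) (eq_sym j i) [(i == j.+1) || _]orbC.
by case: (eqVneq i j) => [->|_] //=; rewrite [row_edge _ _ b a || _]orbC.
Qed.

Lemma grid_edge_col T i j a : (j == i.+1) || (i == j.+1) ->
  grid_edge T i a j a.
Proof. by rewrite /grid_edge eqxx => ->. Qed.

Lemma grid_edgeS T i a : grid_edge T i a i.+1 a.
Proof. by apply: grid_edge_col; rewrite eqxx. Qed.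

Lemma grid_edge_row T i a b : row_edge T i a b -> grid_edge T i a i b.
Proof. by rewrite /grid_edge eqxx => ->; rewrite /= orbT. Qed.

Lemma row_edge_neq T i a : row_edge T i a a = false.
Proof. by case: a => [|[|[|a]]] //=; case: (odd i) => //=; lia. Qed.

Ltac edge_cases := move/grid_edgeP => [[? [?|?]]|[? E]|[? E]]; subst;
  try match goal with H : _.+1 = _.+1 |- _ => case: H => ?; subst end.
Ltac snake_lia :=
  repeat (rewrite /= ?negbK; case: ifP => ?); rewrite /= ?negbK; lia.

Lemma snake_time_early p i c : (3 < c <= p.*2.+1)%N -> (i <= p.*2)%N ->
  (snake_time p.*2 i c < column_start p.*2 3)%N.
Proof.
case: c => [|[|[|[|c]]]] //= cT iT.
have := @column_start_le p.*2 c; snake_lia.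
Qed.

(** The successor along the snake, meaningful for columns beyond 3. *)
Definition snake_next (T i c : nat) : nat * nat :=
  (if odd c then if i == T then (T, c.-1) else (i.+1, c)
   else if i == 0 then (0, c.-1) else (i.-1, c))%N.

(** Hubs are blue from the start and consecutive columns meet only where the snake turns. Hence a
    snake vertex is free to force its successor. *)
Lemma snake_early p i c j b : (3 < c <= p.*2.+1)%N -> (i <= p.*2)%N ->
    (j <= p.*2)%N -> (b <= p.*2.+1)%N -> grid_edge p.*2 i c j b ->
  (snake_time p.*2 j b <= snake_time p.*2 i c)%N \/
  (j, b) = snake_next p.*2 i c.
Proof.
case: c => [|[|[|[|c]]]] //= cT iT jT bT; rewrite /snake_next.
edge_cases.
- rewrite /= !negbK; case: (boolP (odd c)) => oc; [right | left; lia].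
  by rewrite ltn_eqF.
- rewrite /= !negbK; case: (boolP (odd c)) => oc; [left; lia | by right].
- case: b bT E => [|[|[|[|b]]]] //= bT; try lia.
  case/andP=> /eqP[?]; subst b => /eqP ->.
  left; have := @column_startS p.*2 c.+4; snake_lia.
- case: b bT E => [|[|[|[|b]]]] //= bT; first by left.
    by case/andP=> /eqP[?]; subst c => /eqP ->; right.
  case/andP=> /eqP[?]; subst c => /eqP ->; right.
  by rewrite /= !negbK; case: (odd b); rewrite /= ?eqxx.
Qed.

Lemma snake_next_time p i c j b : (3 < c <= p.*2.+1)%N -> (i <= p.*2)%N ->
    (j, b) = snake_next p.*2 i c ->
  (snake_time p.*2 j b <= (snake_time p.*2 i c).+1)%N.
Proof.
case: c => [|[|[|[|c]]]] //= cT iT; rewrite /snake_next /= !negbK.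
have [oc|ec] := boolP (odd c); case: eqP => iE [-> ->]; rewrite /= ?negbK.
- case: c cT oc => [|c] //= cT oc.
  by have := @column_startS p.*2 c.+4; snake_lia.
- by rewrite oc; lia.
- case: c cT ec => [|c] //= cT ec; first by have := @column_startS p.*2 3; lia.
  by have := @column_startS p.*2 c.+4; snake_lia.
- by rewrite (negPf ec); lia.
Qed.

(** The forcer is the predecessor on the snake for columns >= 3, and the hub for its neighbors in
    columns 1 and 2. The remaining vertices of column 2 are forced from the row [i.+1], those of
    column 1 from the row [i.-1], except that (0, 1) is forced by (0, 2). *)
Lemma snake_forcer p i c : (1 < p)%N -> (i <= p.*2)%N -> (c <= p.*2.+1)%N ->
    (0 < snake_time p.*2 i c)%N ->
  exists j b, [/\ (j <= p.*2)%N, (b <= p.*2.+1)%N, grid_edge p.*2 j b i c,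
    (snake_time p.*2 j b < snake_time p.*2 i c)%N &
    forall k d, (k <= p.*2)%N -> (d <= p.*2.+1)%N -> grid_edge p.*2 j b k d ->
      (k, d) <> (i, c) -> (snake_time p.*2 k d < snake_time p.*2 i c)%N].
Proof.
move=> p1 iT cT.
have early j b : (3 < b <= p.*2.+1)%N -> (j <= p.*2)%N ->
    snake_next p.*2 j b = (i, c) -> grid_edge p.*2 j b i c ->
    (snake_time p.*2 j b < snake_time p.*2 i c)%N ->
  exists j b, [/\ (j <= p.*2)%N, (b <= p.*2.+1)%N, grid_edge p.*2 j b i c,
    (snake_time p.*2 j b < snake_time p.*2 i c)%N &
    forall k d, (k <= p.*2)%N -> (d <= p.*2.+1)%N -> grid_edge p.*2 j b k d ->
      (k, d) <> (i, c) -> (snake_time p.*2 k d < snake_time p.*2 i c)%N].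
  move=> bT jT nxt e lt; exists j, b; split=> //; first by lia.
  by move=> k d kT dT /(snake_early bT jT kT dT); rewrite nxt => -[|->//]; lia.
case: c cT early => [|[|[|[|c]]]] // cT early c0.
- have [oi|ei] := boolP (odd i).
    exists i, 0%N; split=> //.
    + by apply: grid_edge_row; rewrite /= oi.
    move=> k d kT dT; edge_cases.
    + by snake_lia.
    + by snake_lia.
    + case: d dT E => [|[|[|[|d]]]] //= dT; rewrite ?oi //=; try snake_lia.
      by have := @snake_time_early p k d.+4; rewrite /=; snake_lia.
    + by case: d dT E => [|[|[|[|d]]]] //=.
  case: i iT ei early c0 => [|i] iT ei early c0.
    exists 0%N, 2%N; split=> //; [by lia | by snake_lia | ].
    move=> k d kT dT; edge_cases => //.
    + by snake_lia.
    + by case: d dT E => [|[|[|[|d]]]] //=; snake_lia.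
    + by case: d dT E => [|[|[|[|d]]]] //=; snake_lia.
  exists i, 1%N; split=> //; first by lia.
  + exact: grid_edgeS.
  + by snake_lia.
  move=> k d kT dT; edge_cases => //.
  + by snake_lia.
  + by case: d dT E => [|[|[|[|d]]]] //=; snake_lia.
  + by case: d dT E => [|[|[|[|d]]]] //=; snake_lia.
- have [oi|ei] := boolP (odd i).
    have iT' : (i < p.*2)%N by lia.
    exists i.+1, 2%N; split=> //.
    + by rewrite grid_edge_sym grid_edgeS.
    + by snake_lia.
    move=> k d kT dT; edge_cases => //.
    + by snake_lia.
    + by case: d dT E => [|[|[|[|d]]]] //=; snake_lia.
    + by case: d dT E => [|[|[|[|d]]]] //=; snake_lia.
  exists i, 0%N; split=> //.
  + by apply: grid_edge_row; rewrite /= (negPf ei).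
  move=> k d kT dT; edge_cases.
  + by snake_lia.
  + by snake_lia.
  + case: d dT E => [|[|[|[|d]]]] //= dT; rewrite ?(negPf ei) //=;
      try snake_lia.
    by have := @snake_time_early p k d.+4; rewrite /=; snake_lia.
  + by case: d dT E => [|[|[|[|d]]]] //=.
- case: i iT early c0 => [|i] iT early c0.
    apply: (early 0%N 4%N) => //; try lia.
    by have := @column_startS p.*2 3; snake_lia.
  exists i, 3%N; split=> //; first by lia.
  + exact: grid_edgeS.
  + by snake_lia.
  move=> k d kT dT; edge_cases => //.
  + by snake_lia.
  + case: d dT E => [|[|[|[|d]]]] //= dT; try snake_lia.
    by have := @snake_time_early p k d.+4; rewrite /=; snake_lia.
  + case: d dT E => [|[|[|[|d]]]] //=; snake_lia.
- have [oc|ec] := boolP (odd c).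
    case: i iT early c0 => [|i] iT early c0.
      (* Row 0 of the last column is the start of the snake, with time 0. *)
      have cT' : (c.+4 <= p.*2)%N.
        rewrite leqNgt; apply: contraL c0 => lt.
        by rewrite /= !negbK oc /column_start (_ : _ - _ = 0)%N //; lia.
      apply: (early 0%N c.+1.+4) => //.
      * by rewrite /snake_next /= !negbK oc.
      * rewrite grid_edge_sym; apply: grid_edge_row.
        by rewrite /= !negbK oc !eqxx.
      * by have := @column_startS p.*2 c.+4; snake_lia.
    apply: (early i c.+4) => //; first lia.
    * by rewrite /snake_next /= !negbK oc ltn_eqF //; lia.
    * exact: grid_edgeS.
    * by snake_lia.
  case: (ltngtP i p.*2) iT => // [iT|iE] _.
    apply: (early i.+1 c.+4) => //.
    * by rewrite /snake_next /= !negbK (negPf ec).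
    * by rewrite grid_edge_sym grid_edgeS.
    * by snake_lia.
  apply: (early p.*2 c.+1.+4) => //; first lia.
  * by rewrite /snake_next /= !negbK ec eqxx iE.
  * rewrite iE grid_edge_sym; apply: grid_edge_row.
    by rewrite /= !negbK (negPf ec) !eqxx.
  * by have := @column_startS p.*2 c.+4; snake_lia.
Qed.

(** A hub is blocked by column 3 if the target is its neighbor in column 1 or 2, and by that
    neighbor otherwise. In columns 1 and 2 the blocker is vertically adjacent, except (0, 1) for the
    target (1, 2). In column 3 it is the neighbor in column 1 or 2 that comes between two steps of
    the snake. Beyond column 3 no neighbor is due late enough to need one. *)
Lemma snake_blocker p i a j b : (1 < p)%N -> (i <= p.*2)%N ->
    (a <= p.*2.+1)%N -> (j <= p.*2)%N -> (b <= p.*2.+1)%N ->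
    grid_edge p.*2 i a j b ->
    ((snake_time p.*2 i a).+1 < snake_time p.*2 j b)%N ->
  exists k d, [/\ (k <= p.*2)%N, (d <= p.*2.+1)%N, grid_edge p.*2 i a k d,
    (k, d) <> (j, b) & (snake_time p.*2 j b <= (snake_time p.*2 k d).+1)%N].
Proof.
move=> p1 iT aT jT bT edge lt.
have [a3 | a3] := ltnP 3 a.
  have aT' : (3 < a <= p.*2.+1)%N by rewrite a3.
  have [|nxt] := snake_early aT' iT jT bT edge; first by lia.
  by have := snake_next_time aT' iT nxt; lia.
case: a a3 aT edge lt => [|[|[|[|a]]]] // _ aT edge lt.
- have bS : (0 < b)%N by case: b lt {bT edge}.
  have eij : i = j by move: edge; edge_cases.
  subst j.
  have [b3 | b3] := eqVneq b (if odd i then 1 else 2)%N.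
    exists i, 3%N; split=> //; [by lia | by apply: grid_edge_row | |].
      by rewrite b3; case: ifP.
    by rewrite b3; snake_lia.
  exists i, (if odd i then 1 else 2)%N; split=> //; first by case: ifP; lia.
  + by apply: grid_edge_row; rewrite /= eqxx orbT.
  + by case=> eb; rewrite eb eqxx in b3.
  have b2 : (2 < b)%N.
    by move: edge b3; rewrite /grid_edge /=;
      case: b bS {bT lt} => [|[|[|b]]] //;
      case: (odd i); rewrite /= ?andbF.
  have lt3 : (3 < b)%N -> (snake_time p.*2 i b < column_start p.*2 3)%N.
    by move=> b4; apply: snake_time_early; rewrite ?b4.
  by case: b {bS b3 edge lt bT} b2 lt3 => [|[|[|[|b]]]] // _ lt3;
    move: lt3; snake_lia.
- have [oi|ei] := boolP (odd i).
    have i0 : (0 < i < p.*2)%N by lia.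
    have [[ej eb] | nj] := eqVneq (j, b) (i.+1, 1)%N.
      exists i.-1, 1%N; split=> //; first by lia.
      * by rewrite grid_edge_sym -{2}(prednK (_ : 0 < i)%N) ?grid_edgeS; lia.
      * by rewrite ej eb; case; lia.
      * by rewrite ej eb; snake_lia.
    exists i.+1, 1%N; split=> //; first by lia.
    * exact: grid_edgeS.
    * by move=> E; rewrite E eqxx in nj.
    move: edge lt nj; edge_cases; rewrite ?eqxx //.
    * by snake_lia.
    * by case: b bT E => [|[|[|[|b]]]] //= bT; rewrite ?oi ?andbF; snake_lia.
    * by case: b bT E => [|[|[|[|b]]]] //= bT; rewrite ?oi ?andbF; snake_lia.
  exfalso; move: edge lt; edge_cases.
  * by snake_lia.
  * by snake_lia.
  * by case: b bT E => [|[|[|[|b]]]] //= bT; rewrite ?(negPf ei) ?andbF;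
      snake_lia.
  * by case: b bT E => [|[|[|[|b]]]] //= bT; rewrite ?(negPf ei) ?andbF;
      snake_lia.
- have [oi|ei] := boolP (odd i).
    exfalso; move: edge lt; edge_cases.
    * by snake_lia.
    * by snake_lia.
    * by case: b bT E => [|[|[|[|b]]]] //= bT; rewrite ?oi ?andbF; snake_lia.
    * by case: b bT E => [|[|[|[|b]]]] //= bT; rewrite ?oi ?andbF; snake_lia.
  have [[ej eb] | nj] := eqVneq (j, b) (i.+1, 2)%N.
    subst j b; case: i ei iT lt {aT edge bT jT} => [|i] ei iT lt.
      by exists 0%N, 1%N; split=> //; snake_lia.
    exists i, 2%N; split=> //; [by lia | by lia | | | ].
    * by rewrite grid_edge_sym grid_edgeS.
    * by case; lia.
    * by snake_lia.
  have [iT'|iT'] := ltnP i p.*2.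
    exists i.+1, 2%N; split=> //.
    * exact: grid_edgeS.
    * by move=> E; rewrite E eqxx in nj.
    move: edge lt nj; edge_cases; rewrite ?eqxx //.
    * by snake_lia.
    * by case: b bT E => [|[|[|[|b]]]] //= bT; snake_lia.
    * by case: b bT E => [|[|[|[|b]]]] //= bT; snake_lia.
  exfalso; move: edge lt {nj}; edge_cases.
  * by lia.
  * by snake_lia.
  * by case: b bT E => [|[|[|[|b]]]] //= bT; snake_lia.
  * by case: b bT E => [|[|[|[|b]]]] //= bT; snake_lia.
- have [ei|] := boolP ((j, b) == (i.+1, 3)%N).
    exists i, (if odd i then 1 else 2)%N; case/eqP: ei => -> ->; split=> //.
    * by case: ifP; lia.
    * by rewrite grid_edge_sym; apply: grid_edge_row; case: ifP => /= ->.
    * by case: ifP => _ [].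
    * by snake_lia.
  move=> nj; exfalso; move: edge lt nj; edge_cases.
  * by rewrite eqxx.
  * by snake_lia.
  * case: b bT E => [|[|[|[|b]]]] //= bT; try snake_lia.
    by have := @snake_time_early p j b.+4; rewrite /=; snake_lia.
  * by case: b bT E => [|[|[|[|b]]]] //= bT; snake_lia.
Qed.

(** * The graph, and boundary counts by rows and columns *)

Section Grid.
Variable p : nat.

Definition grid_adj : rel ('I_p.*2.+1 * 'I_p.*2.+2) :=
  fun u v => grid_edge p.*2 u.1 u.2 v.1 v.2.

Lemma grid_adj_sym : symmetric grid_adj.
Proof. by move=> u v; apply: grid_edge_sym. Qed.

Lemma grid_adj_irrefl : irreflexive grid_adj.
Proof.
move=> u; apply/negP => /grid_edgeP[[_ []]|[_]|[_]];
  rewrite ?row_edge_neq //; lia.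
Qed.

Lemma card_grid_vertex : #|{: 'I_p.*2.+1 * 'I_p.*2.+2}| = (p.*2.+1 * p.*2.+2)%N.
Proof. by rewrite card_prod !card_ord. Qed.

Lemma grid_vertex_gt0 : (0 < #|{: 'I_p.*2.+1 * 'I_p.*2.+2}|)%N.
Proof. by rewrite card_grid_vertex. Qed.

Definition grid : sgraph := SGraph grid_adj_sym grid_adj_irrefl grid_vertex_gt0.

Implicit Types (B D : {set grid}) (i j : 'I_p.*2.+1) (c d : 'I_p.*2.+2).

Definition full B c := [forall i, (i, c) \in B].
Definition white B c := [forall i, (i, c) \notin B].

Lemma mem_boundary B (u v : grid) :
  u \in B -> adj u v -> v \notin B -> u \in boundary B.
Proof. by move=> uB uv vB; apply/boundaryP; split=> //; exists v. Qed.

(** Since the column is a path, blue spreads from [i] to [j] unless some blue vertex has an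
    uncolored neighbor in the column. *)
Lemma mixed_boundary B c : ~~ full B c -> ~~ white B c ->
  exists i, (i, c) \in boundary B.
Proof.
rewrite !negb_forall => /existsP[j jB] /existsP[i]; rewrite negbK => iB.
apply: contrapT => nobd.
have step (k l : 'I_p.*2.+1) : (l == k.+1 :> nat) || (k == l.+1 :> nat) ->
    (k, c) \in B -> (l, c) \in B.
  move=> kl kB; apply: contrapT => /negP lB; apply: nobd; exists k.
  apply: mem_boundary kB _ lB.
  exact: grid_edge_col.
suff : (j, c) \in B by rewrite (negPf jB).
have [n] := ubnP ((i - j) + (j - i))%N.
elim: n => // n IHn in i iB *.
have [<- // | ij] := eqVneq i j.
have {}ij : i != j :> nat by [].
move=> lt_n; have [lt_ij | lt_ji] := ltnP i j.
  have iT : (i.+1 < p.*2.+1)%N by apply: leq_ltn_trans (ltn_ord j).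
  apply: (IHn (Ordinal iT)) => /=; last by lia.
  by apply: step iB; rewrite /= eqxx.
have iT : (i.-1 < p.*2.+1)%N by apply: leq_ltn_trans (ltn_ord i); lia.
apply: (IHn (Ordinal iT)) => /=; last by lia.
by apply: step iB => /=; apply/orP; right; lia.
Qed.

(** The vertices chosen for [C] lie in columns of [C], those for [L] outside; the former are told
    apart by column, the latter by row. *)
Lemma card_cols_rows D (C : {set 'I_p.*2.+2}) (L : {set 'I_p.*2.+1}) :
    (forall c, c \in C -> exists i, (i, c) \in D) ->
    (forall i, i \in L -> exists2 c, c \notin C & (i, c) \in D) ->
  (#|C| + #|L| <= #|D|)%N.
Proof.
move=> colC rowL; pose E := [set u : grid | u.2 \in C].
rewrite -(cardsID E D); apply: leq_add.
  suff sub : C \subset snd @: (D :&: E).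
    exact: leq_trans (subset_leq_card sub) (leq_imset_card _ _).
  apply/subsetP => c cC; have [i icD] := colC c cC.
  by apply/imsetP; exists (i, c); rewrite ?inE ?icD.
suff sub : L \subset fst @: (D :\: E).
  exact: leq_trans (subset_leq_card sub) (leq_imset_card _ _).
apply/subsetP => i iL; have [c cC icD] := rowL i iL.
by apply/imsetP; exists (i, c); rewrite ?inE ?icD ?andbT.
Qed.

Hypothesis p_gt4 : (4 < p)%N.

Let hub : 'I_p.*2.+2 := ord0.
(** Column 1 is exceptional: in even rows other than 0 its vertices have no neighbor outside the
    column, so when full it provides no boundary vertex there. *)
Let X : 'I_p.*2.+2 := inord 1.

Let XE : X = 1%N :> nat. Proof. by rewrite inordK. Qed.

Lemma adj_row i c d : row_edge p.*2 i c d -> @adj grid (i, c) (i, d).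
Proof. exact: grid_edge_row. Qed.

Lemma adj_row_sym i c d : row_edge p.*2 i d c -> @adj grid (i, c) (i, d).
Proof. by rewrite adj_sym; apply: adj_row. Qed.

Lemma card_parity_rows (b : bool) :
  (p <= #|[set i : 'I_p.*2.+1 | odd i == b]|)%N.
Proof.
pose f (k : 'I_p) : 'I_p.*2.+1 := inord (b + k.*2).
have fE k : f k = (b + k.*2)%N :> nat.
  by rewrite inordK //; have := leq_b1 b; have := ltn_ord k; lia.
have inj_f : injective f.
  by move=> k l /(congr1 val); rewrite /= !fE => kl; apply: val_inj => /=; lia.
rewrite -[X in (X <= _)%N]card_ord -(card_imset _ inj_f) subset_leq_card //.
apply/subsetP => _ /imsetP[k _ ->].
by rewrite inE fE oddD odd_double addbF oddb.
Qed.

Lemma card_setC_seq n (s : seq 'I_n) : (n <= #|~: [set d in s]| + size s)%N.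
Proof.
rewrite -{1}(card_ord n) -(cardsC [set d in s]) addnC leq_add2l.
by apply: leq_trans (card_size s); rewrite cardsE.
Qed.

Section Positions.
Variable B : {set grid}.

(* In every row exactly one of the columns 1 and 2 is joined to the hub; where
   column c = 2 is not, column 1 may have to provide the boundary vertex. *)
Lemma row_boundary c d i : full B c -> c != X -> white B d -> (2 < d)%N ->
  if (i, hub) \in B then (i, hub) \in boundary B
  else ((i, c) \in boundary B) || ((i, X) \in boundary B).
Proof.
move=> /forallP fc cX /forallP wd d2; case: ifP => hB.
  by apply: mem_boundary hB _ (wd i); apply: adj_row; rewrite /= d2.
have hN : (i, hub) \notin B by rewrite hB.
have c0 : c != 0%N :> nat.
  by apply: contraFneq hB => c0; rewrite (_ : hub = c) //; apply: val_inj.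
have c1 : c != 1%N :> nat by rewrite -XE.
have [ic | ic] := boolP (row_edge p.*2 i hub c).
  by apply/orP; left; apply: mem_boundary (fc i) _ hN; apply: adj_row_sym.
have [oi c2] : odd i /\ c = 2%N :> nat.
  by move: ic; rewrite /=; case: (odd i); split=> //; lia.
apply/orP; have [XB | XN] := boolP ((i, X) \in B); [right | left].
  by apply: mem_boundary XB _ hN; apply: adj_row_sym; rewrite /= XE oi.
by apply: mem_boundary (fc i) _ XN; apply: adj_row_sym; rewrite XE c2 /= oi.
Qed.

Hypothesis small : (#|boundary B| <= p.*2.+1)%N.

Lemma some_mono : exists c, full B c || white B c.
Proof.
apply: contrapT => /forallNP mono.
have := @card_cols_rows (boundary B) setT set0.
rewrite cardsT card_ord cards0 => le.
suff : (p.*2.+2 + 0 <= #|boundary B|)%N by lia.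
apply: le => [c _ | i]; last by rewrite inE.
by have /negP := mono c; rewrite negb_or => /andP[fc wc]; apply: mixed_boundary.
Qed.

(** Otherwise the columns other than 0, 1 and [c'] give at least 2p - 1 boundary vertices, and each
    of the p odd rows gives one in column 0 or 1: a white hub is seen from column 1, and a blue hub
    sees [c'] unless [c'] is column 2, which column 1 sees. *)
Lemma no_lone_full_X c' : white B c' -> full B X ->
  ~ (forall c, c != X -> c != c' -> ~~ full B c && ~~ white B c).
Proof.
move=> /[dup] wc' /forallP wc fX mixed.
have c'X : c' != X.
  apply: contraTneq fX => <-; rewrite negb_forall.
  by apply/existsP; exists ord0; apply: wc.
pose C := ~: [set d in [:: hub; X; c']].
have cardC : (p.*2.+2 <= #|C| + 3)%N by apply: (card_setC_seq [:: _; _; _]).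
have := @card_cols_rows (boundary B) C [set i : 'I_p.*2.+1 | odd i == true].
have := card_parity_rows true.
move=> cardL le; suff : (#|C| + #|[set i : 'I_p.*2.+1 | odd i == true]| <=
  #|boundary B|)%N by lia.
apply: le => [c | i].
  rewrite !inE !negb_or => /and3P[_ cX cc'].
  by have /andP[] := mixed c cX cc'; apply: mixed_boundary.
rewrite inE => /eqP oi.
have XB := forallP fX i.
have [hB | hN] := boolP ((i, hub) \in B); last first.
  exists X; first by rewrite !inE eqxx orbT.
  by apply: mem_boundary XB _ hN; apply: adj_row_sym; rewrite /= XE oi.
have c'0 : c' != 0%N :> nat.
  by apply: contraTneq hB => c0; rewrite (_ : hub = c') ?wc //; apply: val_inj.
have c'1 : c' != 1%N :> nat by rewrite -XE.
have [c'2 | c'2] := eqVneq (c' : nat) 2.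
  exists X; first by rewrite !inE eqxx orbT.
  by apply: mem_boundary XB _ (wc i); apply: adj_row; rewrite XE c'2 /= oi.
exists hub; first by rewrite !inE eqxx.
by apply: mem_boundary hB _ (wc i); apply: adj_row => /=; apply/orP; left; lia.
Qed.

(** Suppose [d] is mixed. If another column [e] beyond 3 is white, [row_boundary] gives a boundary
    vertex in every row, and [d] gives one more. If none is, almost all columns are mixed, and half
    of the rows give further boundary vertices. *)
Lemma full_white c c' : full B c -> c != X -> white B c' ->
    (forall d, d != X -> d != c -> ~~ full B d) ->
  forall d, (3 < d)%N -> d != c -> white B d.
Proof.
move=> fc cX wc' nfull d d3 dc; apply: contrapT => /negP nwd.
have neX (e : 'I_p.*2.+2) : (3 < e)%N -> e != X.
  by move=> e3; apply: contraTneq e3 => ->; rewrite XE.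
have [[e /and3P[e3 ec we]] | noe] := pselect
    (exists e : 'I_p.*2.+2, [&& (3 < e)%N, e != c & white B e]).
  have := @card_cols_rows (boundary B) [set d] setT.
  rewrite cards1 cardsT card_ord => le.
  suff : (1 + p.*2.+1 <= #|boundary B|)%N by lia.
  apply: le => [b | i _].
    by rewrite inE => /eqP->; apply: mixed_boundary; rewrite ?nfull ?neX.
  have := @row_boundary c e i fc cX we (ltnW e3).
  case: ifP => _ => [hb | /orP[cb | Xb]].
  - by exists hub; rewrite // inE eq_sym; apply: contraTneq d3 => ->.
  - by exists c; rewrite // inE eq_sym.
  - by exists X; rewrite // inE eq_sym neX.
have c'3 : (c' <= 3)%N.
  rewrite leqNgt; apply/negP => c'3; apply: noe; exists c'.
  rewrite c'3 wc' andbT /=; apply: contraTneq fc => <-.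
  by rewrite negb_forall; apply/existsP; exists ord0; move/forallP: wc'.
(* At least 2p - 3 columns are mixed; with p rows this exceeds 2p + 1 because p > 4. *)
pose C := ~: [set d in [:: hub; X; inord 2; inord 3; c]].
have cardC : (p.*2.+2 <= #|C| + 5)%N.
  exact: (card_setC_seq [:: _; _; _; _; _]).
(* In rows of this parity the hub is joined to [c'], unless [c'] is the hub column itself. *)
pose b : bool := c' == X.
have := @card_cols_rows (boundary B) C [set i : 'I_p.*2.+1 | odd i == b].
have := card_parity_rows b.
move=> cardL le; suff : (#|C| + #|[set i : 'I_p.*2.+1 | odd i == b]| <=
  #|boundary B|)%N by lia.
apply: le => [e | i].
  rewrite !inE !negb_or => /and5P[e0 eX e2 e3 ec].
  have e3' : (3 < e)%N.
    have eN n : e != inord n -> e <> n :> nat.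
      by move=> /eqP en E; apply: en; rewrite -E inord_val.
    have e0' : e <> 0%N :> nat by move=> E; case/eqP: e0; apply: val_inj.
    have e1' := eN _ eX; have e2' := eN _ e2; have e3' := eN _ e3.
    by lia.
  apply: mixed_boundary; first by rewrite nfull.
  by apply/negP => we; apply: noe; exists e; rewrite e3' ec we.
rewrite inE => /eqP oi.
move/forallP: fc => fc; move/forallP: wc' => wc'.
have [hB | hN] := boolP ((i, hub) \in B).
  exists hub; first by rewrite !inE eqxx.
  have c'0 : c' != 0%N :> nat.
    apply: contraTneq hB => c0; rewrite (_ : hub = c') ?wc' //.
    exact: val_inj.
  apply: mem_boundary hB _ (wc' i); apply: adj_row => /=.
  rewrite oi /b -val_eqE /= XE.
  by case: (eqVneq (c' : nat) 1) => [-> //|c'1]; case: eqP => //; lia.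
have c0 : c != 0%N :> nat.
  apply: contraNneq hN => c0; rewrite (_ : hub = c) //; exact: val_inj.
have c1 : c != 1%N :> nat by rewrite -XE.
exists c; first by rewrite !inE eqxx !orbT.
have [ic | ic] := boolP (row_edge p.*2 i hub c).
  by apply: mem_boundary (fc i) _ hN; apply: adj_row_sym.
have [oi' c2] : odd i /\ c = 2%N :> nat.
  by move: ic; rewrite /=; case: (odd i); split=> //; lia.
apply: mem_boundary (fc i) _ (wc' i); apply: adj_row_sym.
have /eqP-> : c' == X by rewrite -/b -oi.
by rewrite XE c2 /= oi'.
Qed.

End Positions.

(** * The invariant behind the lower bound on the zero forcing number *)

Lemma early_avoid c d : exists e : 'I_p.*2.+2, [/\ (3 < e)%N, e != c & e != d].
Proof.
have [n [n3 nT nc nd]] : exists n, [/\ 3 < n, n < p.*2.+2, n <> c & n <> d]%N.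
  exists (if (4 != c) && (4 != d) then 4
          else if (5 != c) && (5 != d) then 5 else 6)%N.
  by split; do !case: ifP; lia.
by exists (Ordinal nT); rewrite -!val_eqE /= n3; split=> //; apply/eqP.
Qed.

(** [trapped] or [untrapped] is the invariant of single forces; neither holds of the whole vertex
    set. *)
Definition trapped B :=
  exists2 c, full B c /\ c != X & forall d, (3 < d)%N -> d != c -> white B d.

Definition untrapped B :=
  (exists c, white B c) /\ (forall c, c != X -> ~~ full B c).

Lemma full_not_white B c : full B c -> ~~ white B c.
Proof.
move=> /forallP fc; rewrite negb_forall; apply/existsP.
by exists ord0; rewrite negbK.
Qed.

Lemma whiteU1 B v c : white B c -> v.2 != c -> white (v |: B) c.
Proof.
move=> /forallP wc vc; apply/forallP => i; rewrite !inE negb_or wc andbT.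
by apply: contraNneq vc => <-.
Qed.

Lemma untrapped_force B v : v \notin B ->
    (#|boundary B| <= p.*2.+1)%N -> (#|boundary (v |: B)| <= p.*2.+1)%N ->
  untrapped B -> untrapped (v |: B) \/ trapped (v |: B).
Proof.
move=> vB bB bvB [[c' wc'] nf].
have colv d : full (v |: B) d -> d != X -> v.2 = d.
  move=> /forallP fd /(nf d); rewrite negb_forall => /existsP[i iN].
  by have := fd i; rewrite !inE (negPf iN) orbF => /eqP <-.
(* One force cannot fill a white column, which has more than one row. *)
have not_both d : white B d -> ~~ full (v |: B) d.
  move=> /forallP wd; apply/negP => /forallP fd.
  have := fd ord0; have := fd ord_max.
  rewrite !inE !(negPf (wd _)) !orbF => /eqP <- /eqP[]; lia.
have [[c /andP[fc cX]] | nfull] :=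
    pselect (exists c, full (v |: B) c && (c != X)).
  right; exists c; first by split.
  have wc'' : white (v |: B) c'.
    apply: (whiteU1 wc'); rewrite (colv c) //.
    by apply: contraTneq fc => ->; apply: not_both wc'.
  apply: (full_white _ fc cX wc'') => // d dX dc.
  by apply: contra_neqN dc => fd; rewrite -(colv d fd dX) (colv c fc cX).
have nfull' c : c != X -> ~~ full (v |: B) c.
  by move=> cX; apply/negP => fc; apply: nfull; exists c; rewrite fc.
have [[c wc] | nwhite] := pselect (exists c, white (v |: B) c).
  by left; split=> //; exists c.
have vc c : white B c -> v.2 = c.
  move=> wc; apply: contrapT => /eqP /(whiteU1 wc) wc2; apply: nwhite.
  by exists c.
(* Here [v] lies in the only white column of [B], so the monochromatic column must be a full [X],
   already full in [B]. *)
have [c /orP[fc | wc]] := some_mono bvB; last by case: nwhite; exists c.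
have [cX | cX] := eqVneq c X; last by rewrite (negPf (nfull' c cX)) in fc.
have vX : v.2 != X.
  by rewrite (vc _ wc') -cX; apply: contraTneq fc => <-; apply: not_both wc'.
case: (@no_lone_full_X B bB c' wc') => [|d dX dc'].
  apply/forallP => i; move/forallP: fc => /(_ i); rewrite cX !inE.
  by case: eqP => // E; rewrite -E eqxx in vX.
rewrite nf //=; apply: contraNN dc' => /vc <-.
by rewrite (vc _ wc').
Qed.

(** A force into a white column beyond 3 runs along a row. A hub cannot perform it, having another
    white neighbor there. Any other [u] has its hub as a neighbor, which must be blue; then [u] and
    the hub are two boundary vertices of one row, and every other row has one. *)
Lemma trapped_force B u v : u \in B -> nbhd u :\: B = [set v] ->
    (#|boundary B| <= p.*2.+1)%N -> trapped B -> trapped (v |: B).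
Proof.
move=> uB Nu bB [c [fc cX] wc].
have /setDP[uv vB] : v \in nbhd u :\: B by rewrite Nu set11.
rewrite inE in uv.
exists c => [|d d3 dc].
  split=> //; apply/forallP => i; rewrite inE; apply/orP; right.
  exact: (forallP fc).
apply: (whiteU1 (wc d d3 dc)); apply/negP => /eqP vd.
have wd := wc d d3 dc.
case: u v vd vB uB Nu uv => [i a] [j b] /= -> {b} vB uB Nu uv.
have lone (w : grid) : @adj grid (i, a) w -> w \notin B -> w = (j, d).
  by move=> aw wB; apply/set1P; rewrite -Nu !inE wB.
have [ad | ad] := eqVneq a d.
  by case/negP: (forallP wd i); rewrite -ad.
have eij : i = j.
  case/grid_edgeP: uv => [[/= ad']|[/= /val_inj]|[/= /val_inj]] //.
  by case/eqP: ad; apply: val_inj.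
subst j.
have a0 : a != 0%N :> nat.
  apply: contraTneq d3 => a0.
  have [e [e3 ed ec]] := early_avoid d c.
  suff [E] : (i, e) = (i, d) :> grid by rewrite E eqxx in ed.
  apply: lone; last exact: (forallP (wc e e3 ec)).
  by apply: adj_row; rewrite /= a0 /= (ltnW e3).
have a3 : (2 < a)%N.
  case/grid_edgeP: uv => [[/= ad']|[/= _]|[/= _]].
  - by case/eqP: ad; apply: val_inj.
  - by case: (nat_of_ord a) a0 => [|[|[|a']]] //= _; lia.
  - by case: (nat_of_ord d) d3 => [|[|[|[|d']]]] //= _ /andP[/eqP-> _].
have hB : (i, hub) \in B.
  apply: contrapT => /negP hN.
  suff [E] : (i, hub) = (i, d) :> grid by rewrite -E in d3.
  by apply: lone => //; apply: adj_row_sym; rewrite /= a3.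
have ubd : (i, a) \in boundary B by apply: mem_boundary uB uv vB.
suff : (0 + p.*2.+1 <= #|boundary B :\ ((i, a) : grid)|)%N.
  by move: bB; rewrite (cardsD1 ((i, a) : grid) (boundary B)) ubd; lia.
rewrite -[X in (_ + X <= _)%N](card_ord p.*2.+1) -cardsT -(@cards0 'I_p.*2.+2).
apply: card_cols_rows => [e | k _]; first by rewrite inE.
have := @row_boundary B c d k fc cX wd (ltnW d3).
have [-> | ki] := eqVneq k i.
  rewrite hB => hb; exists hub; first by rewrite inE.
  rewrite in_setD1 hb andbT.
  by apply: contraNneq a0 => -[<-].
have neq e : ((k, e) : grid) != (i, a) by apply: contraNneq ki => -[->].
by case: ifP => _ => [hb | /orP[cb | Xb]];
  [exists hub | exists c | exists X]; rewrite ?in_set0 // in_setD1 neq.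
Qed.

Lemma grid_zero_forcing_ge (S : {set grid}) : zero_forcing S ->
  (p.*2.+2 <= #|S|)%N.
Proof.
move=> zfS; rewrite leqNgt; apply/negP => ltS.
have leS : (#|S| <= p.*2.+1)%N by [].
suff : untrapped [set: grid] \/ trapped [set: grid].
  case=> [[[c /forallP/(_ ord0)]] | [c _ wc]]; first by rewrite inE.
  have [e [e3 ec _]] := early_avoid c c.
  by move/forallP: (wc e e3 ec) => /(_ ord0); rewrite inE.
apply: (@zero_forcing_invariant grid
  (fun B => untrapped B \/ trapped B) S) => //.
  move=> C u v uC Nu bC bvC; have vC : v \notin C.
    by have /setDP[] : v \in nbhd u :\: C by rewrite Nu set11.
  case=> [unC | trC]; last by right; apply: trapped_force Nu _ trC; lia.
  by apply: untrapped_force unC => //; lia.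
have wS c : ~~ white S c -> exists i, (i, c) \in S.
  by rewrite negb_forall => /existsP[i]; rewrite negbK; exists i.
(* Initially the counts apply to [S] itself: a full column exhausts it, and it cannot meet all 2p +
   2 columns. *)
have [[c /andP[fc cX]] | nfull] := pselect (exists c, full S c && (c != X)).
  right; exists c => // d d3 dc; apply: contrapT => /negP /wS[i iS].
  suff : (1 + p.*2.+1 <= #|S|)%N by lia.
  rewrite -[X in (_ + X <= _)%N](card_ord p.*2.+1) -cardsT -(cards1 d).
  apply: card_cols_rows => [e /set1P-> | k _]; first by exists i.
  by exists c; [rewrite inE eq_sym | apply: (forallP fc)].
left; split=> [|c cX]; last first.
  by apply/negP => fc; apply: nfull; exists c; rewrite fc.
apply: contrapT => nwhite.
suff : (p.*2.+2 + 0 <= #|S|)%N by lia.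
rewrite -[X in (X + _ <= _)%N](card_ord p.*2.+2) -cardsT -(@cards0 'I_p.*2.+1).
apply: card_cols_rows => [c _ | i]; last by rewrite inE.
by apply: wS; apply/negP => wc; apply: nwhite; exists c.
Qed.

End Grid.

(** * The fast and the slow process, and equality in the bound *)

Section Sharpness.
Variable p : nat.
Hypothesis p_gt4 : (4 < p)%N.
Local Notation G := (grid p).

Definition row_time (u : G) : nat := u.1.
Definition grid_time (u : G) : nat := snake_time p.*2 u.1 u.2.

Lemma row_forcer (v : G) : (0 < row_time v)%N ->
  exists2 u, adj u v /\ (row_time u < row_time v)%N &
    forall w, adj u w -> w != v -> (row_time w < row_time v)%N.
Proof.
case: v => [[i iT] c]; rewrite /row_time /= => i0.
have jT : (i.-1 < p.*2.+1)%N by lia.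
exists (Ordinal jT, c) => /=.
  split; last by lia.
  by apply: grid_edge_col => /=; apply/orP; left; lia.
move=> [[k kT] d] /= /grid_edgeP[[cd [ki|ki]]|[ki _]|[ki _]];
  rewrite /= in ki *; try lia.
case/eqP; congr pair; last exact/val_inj.
by apply: val_inj => /=; lia.
Qed.

Lemma row_blocker (u v : G) : adj u v -> ((row_time u).+1 < row_time v)%N ->
  exists2 w, adj u w /\ w != v & (row_time v <= (row_time w).+1)%N.
Proof.
by case: u v => i c [j d] /grid_edgeP[[_ []]|[]|[]]; rewrite /row_time /=; lia.
Qed.

Lemma grid_forcer (v : G) : (0 < grid_time v)%N ->
  exists2 u, adj u v /\ (grid_time u < grid_time v)%N &
    forall w, adj u w -> w != v -> (grid_time w < grid_time v)%N.
Proof.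
case: v => i c v0.
have [||||j [b [jT bT e lt uP]]] := @snake_forcer p i c => //; first by lia.
- exact: leq_ord.
- exact: leq_ord.
exists (Ordinal (jT : j < p.*2.+1), Ordinal (bT : b < p.*2.+2))%N => //.
move=> [k d] kd ne; apply: uP kd _; try exact: leq_ord.
by case=> /val_inj ki /val_inj dc; rewrite ki dc eqxx in ne.
Qed.

Lemma grid_blocker (u v : G) : adj u v -> ((grid_time u).+1 < grid_time v)%N ->
  exists2 w, adj u w /\ w != v & (grid_time v <= (grid_time w).+1)%N.
Proof.
case: u v => i a [j b] e lt.
have [|||||k [d [kT dT e' ne le]]] := @snake_blocker p i a j b _ _ _ _ _ e lt;
  try exact: leq_ord; first by lia.
exists (Ordinal (kT : k < p.*2.+1), Ordinal (dT : d < p.*2.+2))%N => //.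
by split=> //; apply: contra_notN ne => /eqP[<- <-].
Qed.

Lemma card_row_start : (#|[set v : G | row_time v == 0%N]| <= p.*2.+2)%N.
Proof.
rewrite -[X in (_ <= X)%N]card_ord -cardsT.
apply: leq_trans (leq_imset_card (fun c => (ord0, c) : G) _).
apply/subset_leq_card/subsetP => -[i c]; rewrite inE => /eqP i0.
by apply/imsetP; exists c => //; congr pair; apply: val_inj.
Qed.

Lemma card_grid_start : (#|[set v : G | grid_time v == 0%N]| <= p.*2.+2)%N.
Proof.
suff sub : [set v : G | grid_time v == 0%N] \subset
    ((ord0, ord_max) : G) |: [set ((i, ord0) : G) | i in setT].
  apply: leq_trans (subset_leq_card sub) _.
  rewrite cardsU1; apply: leq_trans (leq_add (leq_b1 _) (leq_imset_card _ _)) _.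
  by rewrite cardsT card_ord.
apply/subsetP => -[i [c cT]]; rewrite !inE /grid_time /= => t0.
have [c0 | c0] := posnP c.
  apply/orP; right; apply/imsetP; exists i => //; congr pair.
  exact: val_inj.
apply/orP; left; rewrite xpair_eqE -!val_eqE /=.
have iT : (i <= p.*2)%N by rewrite -ltnS.
have pos : (0 < column_start p.*2 3)%N by rewrite /column_start; nia.
case: c cT c0 t0 => [|[|[|[|c]]]] //= cT _; try by snake_lia.
(* Only the last column starts at time 0. *)
have [cE | ec] := eqVneq c.+4 p.*2.+1.
  have oc : odd c by lia.
  by rewrite !negbK oc; lia.
have : (0 < column_start p.*2 c.+4)%N by rewrite /column_start; nia.
snake_lia.
Qed.

Lemma min_zf_grid (S : {set G}) : zero_forcing S -> (#|S| <= p.*2.+2)%N ->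
  min_zf S.
Proof.
move=> zfS leS; apply/min_zfP; split=> // S' zfS'.
exact: leq_trans leS (grid_zero_forcing_ge p_gt4 zfS').
Qed.

Lemma pd_grid (R : realType) : pd G = pd_bound R #|G|.
Proof.
apply/eqP; rewrite eq_le pd_le_bound /=.
have ptG : (pt G <= p.*2)%N.
  have zf := schedule_zero_forcing row_forcer row_blocker.
  have [_ le_pt] := ptP G.
  apply: leq_trans (le_pt _ (min_zf_grid zf card_row_start)) _.
  apply: schedule_prop_time row_forcer row_blocker _ _ => v.
  by rewrite -ltnS; apply: ltn_ord.
have PTG : (p.*2 * p.*2.+2 <= PT G)%N.
  have zf := schedule_zero_forcing grid_forcer grid_blocker.
  have [_ PT_ge] := PTP G.
  apply: leq_trans (PT_ge _ (min_zf_grid zf card_grid_start)).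
  (* The bottom of column 1 is colored last, at time 2p(2p + 2), the order minus the zero forcing
     number. *)
  apply: leq_trans (schedule_prop_time_ge grid_forcer grid_blocker
    (ord_max, inord 1)).
  rewrite /grid_time /= inordK //= odd_double doubleK /column_start; nia.
have pdG : (p.*2 * p.*2.+1)%:Z <= pd G by rewrite /pd; nia.
apply: le_trans pdG; rewrite -ltzD1 /pd_bound floor_lt_int card_grid_vertex.
(* With l = 2p + 1 and n = l(l + 1), l < sqrt n gives n - 2 sqrt n + 1 < l(l - 1) + 1. *)
set n : R := (p.*2.+1 * p.*2.+2)%:R.
have lt_sqrt : (p.*2.+1)%:R < Num.sqrt n.
  rewrite -(@ltr_pXn2r _ 2) ?nnegrE ?sqrtr_ge0 // sqr_sqrtr ?ler0n //.
  by rewrite -natrX ltr_nat; nia.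
have nE : n = (p.*2 * p.*2.+1)%:R + 2 * (p.*2.+1)%:R.
  by rewrite /n -natrM -natrD; congr (_%:R); nia.
by rewrite intrD -pmulrn; lra.
Qed.

End Sharpness.

Theorem theorem4p2 (R : realType) :
  (forall G : sgraph, pd G <= pd_bound R #|G|) /\
  (exists F : nat -> sgraph,
     (forall i j : nat, i <> j -> ~ isomorphic (F i) (F j)) /\
     (forall i : nat, pd (F i) = pd_bound R #|F i|)).
Proof.
split=> [G|]; first exact: pd_le_bound.
(* The shift ensures p > 4; distinct members differ in order. *)
exists (fun i => grid (i + 5)); split=> [i j ij [f bij_f _] | i].
  apply: ij; have := bij_eq_card bij_f; rewrite !card_grid_vertex; nia.
by apply: pd_grid; lia.
Qed.
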